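(* The subgroup $\mathcal H=\langle A,B,C\rangle$ of $\widehat{\mathcal G}$ (with self-similarity biset $\{\mathtt x_1,\mathtt x_2,\mathtt x_3,\mathtt x_4\}\cdot\mathcal H$) is isomorphic as a self-similar group to the group of affine transformations of $\mathbb C$ of the form $z\mapsto\pm z+q$, $q\in\mathbb Z[i]$. The isomorphism identifies $A,B,C$ with the affine transformations (acting from the right) $$z\cdot A=-z+1,\qquad z\cdot B=-z+1+i,\qquad z\cdot C=-z,$$ and the basis of the self-similarity biset with the affine transformations $$z\cdot\mathtt x_1=\tfrac{1}{1+i}z=\tfrac{1-i}{2}z,\qquad z\cdot\mathtt x_2=\tfrac{1}{1+i}(-z+i)=-\tfrac{1-i}{2}z+\tfrac{1+i}{2},$$ $$z\cdot\mathtt x_3=\tfrac{1}{1-i}z=\tfrac{1+i}{2}z,\qquad z\cdot\mathtt x_4=\tfrac{1}{1-i}(-z+1)=-\tfrac{1+i}{2}z+\tfrac{1+i}{2},$$ where the biset structure on affine transformations is given by pre- and post-composition with the group elements: $z\cdot(g\cdot\mathtt x\cdot h)=((z\cdot g)\cdot\mathtt x)\cdot h$. Explicitly, every relation $g\cdot\mathtt x_i=\mathtt x_j\cdot h$ ($g,h\in\mathcal H$) of the biset holds for the corresponding affine maps, where $\mathtt x_1,\mathtt x_2$ generate one direct summand of the biset and $\mathtt x_3,\mathtt x_4$ generate the other.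
   Context: Over an ordered alphabet $(x_1,\dots,x_d)$, a wreath recursion $g=\sigma_g(g_1,\dots,g_d)$ means $g\cdot x_i=x_{\sigma_g(i)}\cdot g_i$ and defines an automorphism of the rooted tree of finite words by $g(x_iv)=x_{\sigma_g(i)}g_i(v)$; in products the right factor acts first. A self-similar group is a pair $(G,\mathfrak M)$ of a group and a $G$-biset $\mathfrak M$ with free right action and finitely many right orbits; a basis is a transversal of right orbits; isomorphism of self-similar groups is a group isomorphism together with a compatible bijection of bisets. For a group generated by a wreath recursion the biset is $\{x_1,\dots,x_d\}\cdot G$, the set of formal products $x_i\cdot g$ with left action determined by the recursion. Let $\sigma=(12)(34)$. $\widehat{\mathcal G}$ is the group generated, over the ordered alphabet $(\hat{\mathtt L}_0,\hat{\mathtt L}_1,\hat{\mathtt R}_0,\hat{\mathtt R}_1)$, by $\alpha_1=\sigma(\beta_1,\beta_1,\beta_1\alpha_1,\alpha_1\beta_1)$, $\beta_1=(1,\beta_1\alpha_1\beta_1,\alpha_1,1)$, $\gamma_1=(\gamma_1,\beta_1,\gamma_1,\beta_1)$, $\alpha_2=\sigma(\beta_2\alpha_2,\alpha_2\beta_2,\beta_2,\beta_2)$, $\beta_2=(\alpha_2,1,1,\beta_2\alpha_2\beta_2)$, $\gamma_2=(\gamma_2,\beta_2,\gamma_2,\beta_2)$. Put $A=\alpha_2$, $B=\beta_1\beta_2$, $C=\gamma_1\gamma_2$ (then $\alpha_1=CAB$), and pass to the basis $\mathtt x_1=\hat{\mathtt L}_0$, $\mathtt x_2=\hat{\mathtt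 L}_1\cdot\beta_1$, $\mathtt x_3=\hat{\mathtt R}_0$, $\mathtt x_4=\hat{\mathtt R}_1\cdot\beta_2$ of the biset of $\widehat{\mathcal G}$. In this basis $A=\sigma(BA,AB,1,1)$, $B=(A,CAB,CAB,A)$, $C=(C,B,C,B)$. *)

(* Defs.v *)
From HB Require Import structures.
From mathcomp Require Import all_boot all_order all_fingroup all_algebra.
From mathcomp Require Import boolp classical_sets reals complex.
From mathcomp Require Import zify ring.

Set Implicit Arguments.
Unset Strict Implicit.
Unset Printing Implicit Defensive.

Import Order.TTheory GRing.Theory Num.Theory.
Local Open Scope group_scope.

#[local] Obligation Tactic := idtac.

(** * Subgroups generated by a set *)

Section GeneratedSubgroup.
Variables (G : groupType) (S : set G).

Definition gen_pred : {pred G} :=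
  [pred g | `[< forall K : {pred G},
      group_closed K -> (forall s, S s -> s \in K) -> g \in K >]].

Lemma gen_closed : group_closed gen_pred.
Proof.
split; first by apply/asboolP => K [].
move=> x y /asboolP gx /asboolP gy; apply/asboolP => K cK sK.
by apply: cK.2; [apply: gx|apply: gy].
Qed.

Lemma mem_gen_pred s : S s -> s \in gen_pred.
Proof. by move=> Ss; apply/asboolP => K _; apply. Qed.

Lemma gen_ind (Q : G -> Prop) :
  Q 1 -> (forall x y, Q x -> Q y -> Q (x * y^-1)) -> (forall s, S s -> Q s) ->
  forall g, g \in gen_pred -> Q g.
Proof.
move=> Q1 QB QS g /asboolP /(_ [pred h | `[< Q h >]]) gQ; apply/asboolP/gQ.
  by split=> [|x y /asboolP Qx /asboolP Qy]; apply/asboolP => //; apply: QB.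
by move=> s Ss; apply/asboolP/QS.
Qed.

Definition gen_group := {g : G | g \in gen_pred}.

HB.instance Definition _ := SubChoice.on gen_group.
HB.instance Definition _ :=
  SubChoice_isSubGroup.Build G (fun g => g \in gen_pred) gen_group gen_closed.

Definition to_gen s (Ss : S s) : gen_group := Sub s (mem_gen_pred Ss).

End GeneratedSubgroup.

(** * Bisets and self-similar groups *)

Record biset (G : groupType) := Biset {
  biset_sort :> Type;
  lact : G -> biset_sort -> biset_sort;
  ract : biset_sort -> G -> biset_sort;
  lact1 : forall m, lact 1 m = m;
  lactM : forall g h m, lact (g * h) m = lact g (lact h m);
  ract1 : forall m, ract m 1 = m;
  ractM : forall g h m, ract m (g * h) = ract (ract m g) h;
  lractA : forall g m h, ract (lact g m) h = lact g (ract m h) }.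

Arguments lact {G b}.
Arguments ract {G b}.

Notation "g •> m" := (lact g m) (at level 38, right associativity).
Notation "m <• g" := (ract m g) (at level 40, left associativity).

Section BisetPredicates.
Variables (G : groupType) (M : biset G).

Definition right_free := forall (m : M) (g : G), m <• g = m -> g = 1.

Definition finite_right_orbits :=
  exists (n : nat) (b : 'I_n -> M), forall m, exists i g, m = b i <• g.

(** A transversal of the right orbits. *)
Definition is_basis (n : nat) (b : 'I_n -> M) :=
  forall m, exists! i, exists g, m = b i <• g.

(** The sub-biset [G.S.G]. *)
Definition generated_biset (S : set M) : set M :=
  [set m | exists g s h, S s /\ m = g •> s <• h]%classic.

Definition is_subbiset (N : set M) :=
  (forall g m, N m -> N (g •> m)) /\ (forall m g, N m -> N (m <• g)).

(** Direct sums of bisets are disjoint unions. *)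
Definition is_direct_sum (N1 N2 : set M) :=
  [/\ is_subbiset N1, is_subbiset N2,
      (N1 `|` N2 = setT)%classic & (N1 `&` N2 = set0)%classic].

End BisetPredicates.

Record selfsimilar := SelfSimilar {
  ss_group :> groupType;
  ss_biset : biset ss_group;
  ss_free : right_free ss_biset;
  ss_finite : finite_right_orbits ss_biset }.

(** The right action by [h] is applied last: [g •> m <• h] is [(g.m).h]. *)
Record ss_iso (S T : selfsimilar) := SSIso {
  iso_group : S -> T;
  iso_biset : ss_biset S -> ss_biset T;
  iso_groupM : {morph iso_group : g h / g * h};
  iso_group_bij : bijective iso_group;
  iso_biset_bij : bijective iso_biset;
  iso_bisetM : forall g m h,
    iso_biset (g •> m <• h) = iso_group g •> iso_biset m <• iso_group h }.

Section RegularBiset.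
Variable G : groupType.

Definition regular_biset : biset G.
Proof.
refine (@Biset G G (fun g m => g * m) (fun m g => m * g) _ _ _ _ _).
- exact: mul1g.
- by move=> g h m; rewrite mulgA.
- exact: mulg1.
- by move=> g h m; rewrite mulgA.
- by move=> g m h; rewrite mulgA.
Defined.

Lemma regular_free : right_free regular_biset.
Proof. by move=> /= m g /(congr1 (monoid.mul m^-1)); rewrite mulKg mulVg. Qed.

End RegularBiset.

(** For a subgroup [K] of [G] and elements [b i] of a [G]-biset such that
    [{b i}.K] is invariant under the left action of [K], the self-similar group
    formed by [K] and [{b i}.K]. *)

Section SpannedBiset.
Variables (G : groupType) (M : biset G) (freeM : right_free M).
Variables (P : {pred G}) (K : subGroupType P).
Variables (n : nat) (b : 'I_n -> M).

Definition span : set M :=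
  [set m | exists (i : 'I_n) (k : K), m = b i <• \val k]%classic.

Definition left_invariant_span :=
  forall (k : K) (i : 'I_n), span (\val k •> b i).

Hypothesis invb : left_invariant_span.

Lemma span_lact (k : K) m : span m -> span (\val k •> m).
Proof.
move=> [i [h ->]]; have [j [k' e]] := invb k i.
by exists j, (k' * h); rewrite -lractA e -ractM gmulfM.
Qed.

Lemma span_ract (k : K) m : span m -> span (m <• \val k).
Proof. by move=> [i [h ->]]; exists i, (h * k); rewrite -ractM gmulfM. Qed.

Lemma spanE (u v : {m | span m}) : sval u = sval v -> u = v.
Proof.
by case: u v => [u pu] [v pv] /= e; subst v; congr exist; exact: Prop_irrelevance.
Qed.

Definition span_biset : biset K.
Proof.
refine (@Biset K {m | span m}
  (fun k m => exist _ _ (span_lact k (svalP m)))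
  (fun m k => exist _ _ (span_ract k (svalP m))) _ _ _ _ _).
- by move=> m; apply: spanE; rewrite /= gmulf1 lact1.
- by move=> g h m; apply: spanE; rewrite /= gmulfM lactM.
- by move=> m; apply: spanE; rewrite /= gmulf1 ract1.
- by move=> g h m; apply: spanE; rewrite /= gmulfM ractM.
- by move=> g m h; apply: spanE; rewrite /= lractA.
Defined.

Lemma span_base i : span (b i).
Proof. by exists i, 1; rewrite gmulf1 ract1. Qed.

Definition span_elt i : span_biset := exist _ _ (span_base i).

Lemma span_free : right_free span_biset.
Proof.
by move=> m k /(congr1 sval) /= /freeM e; apply: val_inj; rewrite e gmulf1.
Qed.

Lemma span_finite : finite_right_orbits span_biset.
Proof.
exists n, span_elt => -[m pm]; have [i [k e]] := pm.
by exists i, k; apply: spanE.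
Qed.

Definition span_selfsimilar : selfsimilar := SelfSimilar span_free span_finite.

End SpannedBiset.

Lemma gen_left_invariant (G : groupType) (M : biset G) (S : set G)
    (n : nat) (b : 'I_n -> M) :
  (forall s, S s -> exists (p : 'S_n) (k : 'I_n -> gen_group S),
     forall i, s •> b i = b (p i) <• \val (k i)) ->
  left_invariant_span (gen_group S) b.
Proof.
move=> Sb.
pose Q g := exists (p : 'S_n) (k : 'I_n -> gen_group S),
  forall i, g •> b i = b (p i) <• \val (k i).
suff QH g : g \in gen_pred S -> Q g.
  by move=> k i; have [p [h e]] := QH _ (valP k); exists (p i), (h i).
move: g; apply: gen_ind => [|x y [p [h ph]] [q [k qk]]|//].
  by exists 1, (fun=> 1) => i; rewrite lact1 perm1 gmulf1 ract1.
exists (q^-1 * p)%g, (fun i => h (q^-1 i)%g * (k (q^-1 i)%g)^-1) => i.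
rewrite permM lactM.
have -> : y^-1 •> b i = b (q^-1 i)%g <• (\val (k (q^-1 i)%g))^-1.
  rewrite -[b i](ract1 (b:=M)) -(mulgV (\val (k (q^-1 i)%g))) ractM.
  have := qk (q^-1 i)%g; rewrite permKV => <-.
  by rewrite -lractA -lactM mulVg lact1.
by rewrite -lractA ph -ractM gmulfM gmulfV.
Qed.

(** * Automorphisms of the rooted tree of finite words over ['I_d] *)

Section TreeAutomorphisms.
Variable d : nat.
Local Notation word := (seq 'I_d).

(** Bijections fixing the root (the empty word) and mapping children of [v]
    to children of the image of [v]. *)
Record tree_aut := TreeAut {
  tfun :> word -> word;
  tinv : word -> word;
  tfunK : cancel tfun tinv;
  tinvK : cancel tinv tfun;
  tfun_root : tfun [::] = [::];
  tfun_child : forall v x, exists y, tfun (rcons v x) = rcons (tfun v) y }.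

Lemma tree_aut_ext (g h : tree_aut) : g =1 h -> g = h.
Proof.
case: g h => [f f' fK f'K f0 fr] [g g' gK g'K g0 gr] /= efg.
have {efg}E : f = g by apply/funext.
subst g; have E : f' = g'.
  by apply/funext => v; apply: (can_inj fK); rewrite f'K g'K.
by subst g'; congr TreeAut; exact: Prop_irrelevance.
Qed.

Program Definition tree_one := @TreeAut id id _ _ _ _.
Next Obligation. by []. Qed.
Next Obligation. by []. Qed.
Next Obligation. by []. Qed.
Next Obligation. by move=> v x; exists x. Qed.

(** In a product the right factor acts first. *)
Program Definition tree_mul (g h : tree_aut) :=
  @TreeAut (g \o h) (tinv h \o tinv g) _ _ _ _.
Next Obligation. by move=> g h v /=; rewrite !tfunK. Qed.
Next Obligation. by move=> g h v /=; rewrite !tinvK. Qed.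
Next Obligation. by move=> g h /=; rewrite !tfun_root. Qed.
Next Obligation.
move=> g h v x /=; have [y ->] := tfun_child h v x; exact: tfun_child.
Qed.

Program Definition tree_inv (g : tree_aut) := @TreeAut (tinv g) g _ _ _ _.
Next Obligation. exact: tinvK. Qed.
Next Obligation. exact: tfunK. Qed.
Next Obligation. by move=> g; rewrite -[X in tinv g X](tfun_root g) tfunK. Qed.
Next Obligation.
move=> g w y; case/lastP E: (tinv g (rcons w y)) => [|v x].
  have := tinvK g (rcons w y); rewrite E tfun_root.
  by move=> /(congr1 size); rewrite size_rcons.
exists x; congr rcons; have := tinvK g (rcons w y); rewrite E.
by have [z ->] := tfun_child g v x => /rcons_inj [<- _]; rewrite tfunK.
Qed.

HB.instance Definition _ := gen_eqMixin tree_aut.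
HB.instance Definition _ := gen_choiceMixin tree_aut.

Lemma tree_mulA : associative tree_mul.
Proof. by move=> f g h; apply: tree_aut_ext. Qed.
Lemma tree_mul1 : left_id tree_one tree_mul.
Proof. by move=> f; apply: tree_aut_ext. Qed.
Lemma tree_1mul : right_id tree_one tree_mul.
Proof. by move=> f; apply: tree_aut_ext. Qed.
Lemma tree_mulV : left_inverse tree_one tree_inv tree_mul.
Proof. by move=> f; apply: tree_aut_ext => v /=; rewrite tfunK. Qed.
Lemma tree_Vmul : right_inverse tree_one tree_inv tree_mul.
Proof. by move=> f; apply: tree_aut_ext => v /=; rewrite tinvK. Qed.

HB.instance Definition _ :=
  isGroup.Build tree_aut tree_mulA tree_mul1 tree_1mul tree_mulV tree_Vmul.

Lemma tree_mulE (g h : tree_aut) v : (g * h) v = g (h v).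
Proof. by []. Qed.

(** [g] maps [x :: v] to [letter g x :: section g x v]. *)
Definition letter (g : tree_aut) (x : 'I_d) : 'I_d := head x (g [:: x]).

Lemma tree_cons g x v : exists w, tfun g (x :: v) = letter g x :: w.
Proof.
elim/last_ind: v => [|v y [w e]].
  rewrite /letter; have [y] := tfun_child g [::] x.
  by rewrite tfun_root /= => ->; exists [::].
by have [z] := tfun_child g (x :: v) y; rewrite rcons_cons e => ->; exists (rcons w z).
Qed.

Lemma tree_consE g x v :
  tfun g (x :: v) = letter g x :: behead (g (x :: v)).
Proof. by have [w ->] := tree_cons g x v. Qed.

Lemma letterM g h x : letter (g * h) x = letter g (letter h x).
Proof.
rewrite {1}/letter tree_mulE; have [w ->] := tree_cons h x [::].
by have [w' ->] := tree_cons g (letter h x) w.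
Qed.

Lemma letter1 x : letter 1 x = x. Proof. by []. Qed.

Lemma letterK g : cancel (letter g) (letter g^-1).
Proof. by move=> x; rewrite -letterM mulVg. Qed.

Lemma letterVK g : cancel (letter g^-1) (letter g).
Proof. by move=> x; rewrite -letterM mulgV. Qed.

Program Definition section (g : tree_aut) (x : 'I_d) :=
  @TreeAut (fun v => behead (g (x :: v)))
           (fun v => behead (tinv g (letter g x :: v))) _ _ _ _.
Next Obligation. by move=> g x v /=; rewrite -tree_consE tfunK. Qed.
Next Obligation.
move=> g x v /=; have := tree_consE g^-1 (letter g x) v.
by rewrite letterK => <-; rewrite [g _](tinvK g).
Qed.
Next Obligation.
move=> g x /=; have [y] := tfun_child g [::] x.
by rewrite tfun_root /= => ->.
Qed.
Next Obligation.
move=> g x v y /=; have [z] := tfun_child g (x :: v) y.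
by rewrite rcons_cons => ->; rewrite tree_consE; exists z.
Qed.

Lemma tree_section g x v : tfun g (x :: v) = letter g x :: section g x v.
Proof. exact: tree_consE. Qed.

Lemma sectionM g h x : section (g * h) x = section g (letter h x) * section h x.
Proof.
apply: tree_aut_ext => v.
have : (g * h) (x :: v) = g (h (x :: v)) by [].
by rewrite (tree_section h) !tree_section => -[].
Qed.

Lemma section1 x : section 1 x = 1.
Proof. by apply: tree_aut_ext. Qed.

Lemma sectionV g x : section g^-1 x = (section g (letter g^-1 x))^-1.
Proof.
apply: (can_inj (mulKg (section g (letter g^-1 x)))).
by rewrite -sectionM mulgV section1 mulgV.
Qed.

End TreeAutomorphisms.

(** * Wreath recursions *)

(** [rec s = (sigma, (w_0, ..., w_(d-1)))] encodes the equation
    [s = sigma(w_0, ..., w_(d-1))], where a word in the generators denotes the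
    product of its letters, the rightmost one acting first. *)

Section WreathRecursion.
Variables (d : nat) (I : Type) (rec : I -> 'S_d * d.-tuple (seq I)).

(** First-level permutation and sections of a product, obtained from
    [(g h)|_x = g|_(h x) h|_x]. *)
Definition word_letter (w : seq I) (x : 'I_d) : 'I_d :=
  foldr (fun s y => (rec s).1 y) x w.

Fixpoint word_section (w : seq I) (x : 'I_d) : seq I :=
  if w is s :: w' then tnth (rec s).2 (word_letter w' x) ++ word_section w' x
  else [::].

Fixpoint word_act (w : seq I) (v : seq 'I_d) : seq 'I_d :=
  if v is x :: v' then word_letter w x :: word_act (word_section w x) v'
  else [::].

Definition word_letterV (w : seq I) (x : 'I_d) : 'I_d :=
  foldl (fun y s => ((rec s).1^-1)%g y) x w.

Fixpoint word_actV (w : seq I) (v : seq 'I_d) : seq 'I_d :=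
  if v is x :: v' then
    word_letterV w x :: word_actV (word_section w (word_letterV w x)) v'
  else [::].

Lemma word_letterK w : cancel (word_letter w) (word_letterV w).
Proof. by elim: w => [|s w IH] x //=; rewrite permK; apply: IH. Qed.

Lemma word_letterVK w : cancel (word_letterV w) (word_letter w).
Proof. by elim: w => [|s w IH] x //=; rewrite IH permKV. Qed.

Program Definition wreath_aut (s : I) : tree_aut d :=
  @TreeAut d (word_act [:: s]) (word_actV [:: s]) _ _ _ _.
Next Obligation.
move=> s v; elim: v [:: s] => [|x v IH] w //=.
by rewrite word_letterK IH.
Qed.
Next Obligation.
move=> s v; elim: v [:: s] => [|x v IH] w //=.
by rewrite word_letterVK IH.
Qed.
Next Obligation. by []. Qed.
Next Obligation.
move=> s v x; elim: v [:: s] => [|z v IH] w; first by exists (word_letter w x).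
by rewrite rcons_cons /=; have [y ->] := IH (word_section w z); exists y.
Qed.

Lemma word_act_cat u w v : word_act (u ++ w) v = word_act u (word_act w v).
Proof.
elim: v u w => [|x v IH] u w //=.
have E u' : word_letter (u' ++ w) x = word_letter u' (word_letter w x).
  by rewrite /word_letter foldr_cat.
rewrite E -IH; congr (_ :: word_act _ v).
by elim: u => [|s u IHu] //=; rewrite IHu catA E.
Qed.

Lemma size_word_act w v : size (word_act w v) = size v.
Proof. by elim: v w => [|x v IH] w //=; rewrite IH. Qed.

Lemma word_act0 v : word_act [::] v = v.
Proof. by elim: v => //= x v ->. Qed.

Lemma word_actE w v : word_act w v = (\prod_(s <- w) wreath_aut s) v.
Proof.
elim: w v => [|s w IH] v; first by rewrite big_nil word_act0.
by rewrite big_cons tree_mulE -IH -cat1s word_act_cat.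
Qed.

Lemma wreath_letter s x : letter (wreath_aut s) x = (rec s).1 x.
Proof. by []. Qed.

Lemma wreath_section s x :
  section (wreath_aut s) x = \prod_(t <- tnth (rec s).2 x) wreath_aut t.
Proof.
by apply: tree_aut_ext => v; rewrite -word_actE /= cats0.
Qed.

Definition wreath_group := gen_group (range wreath_aut).

Definition wreath_gen (s : I) : wreath_group :=
  to_gen (ex_intro2 _ _ s Logic.I erefl).

Lemma section_closed (g : wreath_group) x :
  section (\val g) x \in gen_pred (range wreath_aut).
Proof.
move: (\val g) (valP g) x; apply: gen_ind => [x|g1 g2 G1 G2 x|_ [s _ <-] x].
- by rewrite section1; apply: (gen_closed _).1.
- by rewrite sectionM sectionV; apply: (gen_closed _).2.
rewrite wreath_section.
elim: (tnth _ _) => [|t w IH]; first by rewrite big_nil (gen_closed _).1.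
rewrite big_cons; apply: (group_closedM (gen_closed _)) => //.
by apply: mem_gen_pred; exists t.
Qed.

Definition wreath_sect (g : wreath_group) x : wreath_group :=
  Sub (section (\val g) x) (section_closed g x).

Lemma wreath_letterM (g h : wreath_group) x :
  letter (\val (g * h)) x = letter (\val g) (letter (\val h) x).
Proof. by rewrite gmulfM letterM. Qed.

Lemma wreath_sectM g h x :
  wreath_sect (g * h) x = wreath_sect g (letter (\val h) x) * wreath_sect h x.
Proof.
apply: val_inj; rewrite [RHS]gmulfM -[RHS]sectionM.
by rewrite -[in RHS]gmulfM.
Qed.

(** The formal products [x.h], with [g.(x.h) = g(x).(g|_x h)]. *)
Definition wreath_biset : biset wreath_group.
Proof.
refine (@Biset wreath_group ('I_d * wreath_group)%type
  (fun g m => (letter (\val g) m.1, wreath_sect g m.1 * m.2))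
  (fun m h => (m.1, m.2 * h)) _ _ _ _ _).
- case=> x h /=; rewrite letter1; congr pair; apply: val_inj.
  by rewrite gmulfM /= section1 mul1g.
- by move=> g h [x k]; rewrite wreath_letterM wreath_sectM -mulgA.
- by case=> x h; rewrite mulg1.
- by move=> g h [x k]; rewrite /= mulgA.
- by move=> g [x k] h; rewrite /= mulgA.
Defined.

Lemma wreath_free : right_free wreath_biset.
Proof.
by move=> [x h] g /= [] /(congr1 (monoid.mul h^-1)); rewrite mulKg mulVg.
Qed.

Definition wreath_letter_elt (x : 'I_d) : wreath_biset := (x, 1).

Lemma wreath_finite : finite_right_orbits wreath_biset.
Proof. by exists d, wreath_letter_elt => -[x h]; exists x, h; rewrite /= mul1g. Qed.

Definition wreath_selfsimilar := SelfSimilar wreath_free wreath_finite.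

Lemma val_wreath_word w :
  \val (\prod_(t <- w) wreath_gen t) = \prod_(t <- w) wreath_aut t.
Proof.
elim: w => [|t w IH]; first by rewrite !big_nil.
by rewrite !big_cons -IH; apply: gmulfM.
Qed.

Lemma wreath_recursion s x :
  wreath_gen s •> wreath_letter_elt x =
  wreath_letter_elt ((rec s).1 x) <• \prod_(t <- tnth (rec s).2 x) wreath_gen t.
Proof.
congr pair; rewrite mulg1 mul1g; apply: val_inj.
by rewrite val_wreath_word -wreath_section.
Qed.

Lemma eq_wreath_word u w : word_act u =1 word_act w ->
  \prod_(t <- u) wreath_gen t = \prod_(t <- w) wreath_gen t.
Proof.
move=> uw; apply: val_inj; rewrite !val_wreath_word; apply: tree_aut_ext => v.
by rewrite -!word_actE.
Qed.

End WreathRecursion.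

(** * The group [Ghat] and its subgroup [H] *)

Definition L0 : 'I_4 := @Ordinal 4 0 isT.
Definition L1 : 'I_4 := @Ordinal 4 1 isT.
Definition R0 : 'I_4 := @Ordinal 4 2 isT.
Definition R1 : 'I_4 := @Ordinal 4 3 isT.

Definition swap : 'S_4 := (tperm L0 L1 * tperm R0 R1)%g.

Inductive hat_gen := alpha1 | beta1 | gamma1 | alpha2 | beta2 | gamma2.

Definition hat_rec (s : hat_gen) : 'S_4 * 4.-tuple (seq hat_gen) :=
  match s with
  | alpha1 => (swap, [tuple [:: beta1]; [:: beta1];
                            [:: beta1; alpha1]; [:: alpha1; beta1]])
  | beta1 => (1%g, [tuple [::]; [:: beta1; alpha1; beta1]; [:: alpha1]; [::]])
  | gamma1 => (1%g, [tuple [:: gamma1]; [:: beta1]; [:: gamma1]; [:: beta1]])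
  | alpha2 => (swap, [tuple [:: beta2; alpha2]; [:: alpha2; beta2];
                            [:: beta2]; [:: beta2]])
  | beta2 => (1%g, [tuple [:: alpha2]; [::]; [::]; [:: beta2; alpha2; beta2]])
  | gamma2 => (1%g, [tuple [:: gamma2]; [:: beta2]; [:: gamma2]; [:: beta2]])
  end.

Definition Ghat : groupType := wreath_group hat_rec.
Definition Ghat_biset : biset Ghat := wreath_biset hat_rec.

Local Notation "# s" := (wreath_gen hat_rec s) (at level 2, format "# s").
Definition hat_letter (x : 'I_4) : Ghat_biset := wreath_letter_elt hat_rec x.

Definition hatA : Ghat := #alpha2.
Definition hatB : Ghat := #beta1 * #beta2.
Definition hatC : Ghat := #gamma1 * #gamma2.

Definition hat_basis (i : 'I_4) : Ghat_biset :=
  tnth [tuple hat_letter L0; hat_letter L1 <• #beta1;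
              hat_letter R0; hat_letter R1 <• #beta2] i.

Lemma I4_ind (Q : 'I_4 -> Prop) : Q L0 -> Q L1 -> Q R0 -> Q R1 -> forall i, Q i.
Proof.
move=> q0 q1 q2 q3 [[|[|[|[|//]]]] p]; [set u := L0|set u := L1|set u := R0|set u := R1];
by rewrite (_ : Ordinal p = u) //; apply: val_inj.
Qed.

Lemma swapE : [/\ swap L0 = L1, swap L1 = L0, swap R0 = R1 & swap R1 = R0].
Proof.
rewrite /swap !permM !permE /=; do 4?split;
by apply: val_inj; rewrite !permE.
Qed.

Local Notation act s := (word_act hat_rec [:: s]).

Lemma act_cons s t w v :
  word_act hat_rec [:: s, t & w] v = act s (word_act hat_rec (t :: w) v).
Proof. by rewrite -word_act_cat. Qed.

Lemma act_step s x v : act s (x :: v) =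
  (hat_rec s).1 x :: word_act hat_rec (tnth (hat_rec s).2 x) v.
Proof. by rewrite /= cats0. Qed.

Lemma tnth_hat s x : tnth (hat_rec s).2 x = nth [::] (hat_rec s).2 x.
Proof. exact: tnth_nth. Qed.

Definition swapEs : (swap L0 = L1) * (swap L1 = L0) * (swap R0 = R1) *
  (swap R1 = R0).
Proof. by have [? ? ? ?] := swapE. Qed.

Lemma actE :
  (forall v, act alpha1 (L0 :: v) = L1 :: act beta1 v) *
  (forall v, act alpha1 (L1 :: v) = L0 :: act beta1 v) *
  (forall v, act alpha1 (R0 :: v) = R1 :: act beta1 (act alpha1 v)) *
  (forall v, act alpha1 (R1 :: v) = R0 :: act alpha1 (act beta1 v)) *
  (forall v, act beta1 (L0 :: v) = L0 :: v) *
  (forall v, act beta1 (L1 :: v) = L1 :: act beta1 (act alpha1 (act beta1 v))) *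
  (forall v, act beta1 (R0 :: v) = R0 :: act alpha1 v) *
  (forall v, act beta1 (R1 :: v) = R1 :: v) *
  (forall v, act gamma1 (L0 :: v) = L0 :: act gamma1 v) *
  (forall v, act gamma1 (L1 :: v) = L1 :: act beta1 v) *
  (forall v, act gamma1 (R0 :: v) = R0 :: act gamma1 v) *
  (forall v, act gamma1 (R1 :: v) = R1 :: act beta1 v) *
  (forall v, act alpha2 (L0 :: v) = L1 :: act beta2 (act alpha2 v)) *
  (forall v, act alpha2 (L1 :: v) = L0 :: act alpha2 (act beta2 v)) *
  (forall v, act alpha2 (R0 :: v) = R1 :: act beta2 v) *
  (forall v, act alpha2 (R1 :: v) = R0 :: act beta2 v) *
  (forall v, act beta2 (L0 :: v) = L0 :: act alpha2 v) *
  (forall v, act beta2 (L1 :: v) = L1 :: v) *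
  (forall v, act beta2 (R0 :: v) = R0 :: v) *
  (forall v, act beta2 (R1 :: v) = R1 :: act beta2 (act alpha2 (act beta2 v))) *
  (forall v, act gamma2 (L0 :: v) = L0 :: act gamma2 v) *
  (forall v, act gamma2 (L1 :: v) = L1 :: act beta2 v) *
  (forall v, act gamma2 (R0 :: v) = R0 :: act gamma2 v) *
  (forall v, act gamma2 (R1 :: v) = R1 :: act beta2 v).
Proof.
do 23?apply: pair; move=> v; rewrite act_step tnth_hat /= ?swapEs ?perm1 ?act_cons ?word_act0 //.
Qed.

Lemma act_relations n v : size v <= n ->
  [/\ act alpha1 (act alpha1 v) = v, act alpha2 (act alpha2 v) = v,
      act beta1 (act beta1 v) = v, act beta2 (act beta2 v) = v &
      act beta1 (act beta2 v) = act beta2 (act beta1 v)] /\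
  act gamma1 (act gamma2 (act alpha2 (act beta1 (act beta2 v)))) = act alpha1 v.
Proof.
elim: n v => [|n IH] [|x v] //; rewrite [size _]/= ltnS => sv.
have sz s u : (size (act s u) <= n) = (size u <= n) by rewrite size_word_act.
have a1 u : size u <= n -> act alpha1 (act alpha1 u) = u by case/IH => -[].
have a2 u : size u <= n -> act alpha2 (act alpha2 u) = u by case/IH => -[].
have b1 u : size u <= n -> act beta1 (act beta1 u) = u by case/IH => -[].
have b2 u : size u <= n -> act beta2 (act beta2 u) = u by case/IH => -[].
have b12 u : size u <= n -> act beta2 (act beta1 u) = act beta1 (act beta2 u).
  by case/IH => -[].
have cab u : size u <= n ->
    act gamma1 (act gamma2 (act alpha2 u)) = act alpha1 (act beta1 (act beta2 u)).
  move=> su; have [_] := IH (act beta2 (act beta1 u)) ltac:(by rewrite !sz).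
  by rewrite b2 ?sz // b1 // b12.
move: x; elim/I4_ind; rewrite !actE; (do 2?split); congr cons;
  rewrite ?(cab, b12, a1, a2, b1, b2, sz) //.
Qed.

Lemma hat_relations :
  [/\ #alpha1 * #alpha1 = 1, #alpha2 * #alpha2 = 1,
      #beta1 * #beta1 = 1, #beta2 * #beta2 = 1 &
      #beta1 * #beta2 = #beta2 * #beta1] /\
  #gamma1 * (#gamma2 * (#alpha2 * (#beta1 * #beta2))) = #alpha1.
Proof.
have E := @eq_wreath_word _ _ hat_rec.
do 2?split.
- by have := E [:: alpha1; alpha1] [::]; rewrite !big_cons !big_nil !mulg1; apply=> v;
    rewrite !act_cons word_act0; have [[]] := act_relations (leqnn (size v)).
- by have := E [:: alpha2; alpha2] [::]; rewrite !big_cons !big_nil !mulg1; apply=> v;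
    rewrite !act_cons word_act0; have [[]] := act_relations (leqnn (size v)).
- by have := E [:: beta1; beta1] [::]; rewrite !big_cons !big_nil !mulg1; apply=> v;
    rewrite !act_cons word_act0; have [[]] := act_relations (leqnn (size v)).
- by have := E [:: beta2; beta2] [::]; rewrite !big_cons !big_nil !mulg1; apply=> v;
    rewrite !act_cons word_act0; have [[]] := act_relations (leqnn (size v)).
- by have := E [:: beta1; beta2] [:: beta2; beta1]; rewrite !big_cons !big_nil !mulg1; apply=> v;
    rewrite !act_cons; have [[]] := act_relations (leqnn (size v)).
by have := E [:: gamma1; gamma2; alpha2; beta1; beta2] [:: alpha1];
  rewrite !big_cons !big_nil !mulg1; apply=> v; rewrite !act_cons;
  have [] := act_relations (leqnn (size v)).
Qed.

Lemma alpha1E : #alpha1 = hatC * hatA * hatB.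
Proof. by have [_ <-] := hat_relations; rewrite /hatA /hatB /hatC !mulgA. Qed.

#[local] Arguments lact {G b} : simpl never.
#[local] Arguments ract {G b} : simpl never.

Lemma hat_lactE s x h : #s •> (hat_letter x <• h) =
  hat_letter ((hat_rec s).1 x) <•
  (\prod_(t <- nth [::] (hat_rec s).2 x) #t * h).
Proof. by rewrite -lractA wreath_recursion tnth_hat -ractM. Qed.

Lemma hat_basisE :
  (hat_basis L0 = hat_letter L0 <• 1) * (hat_basis L1 = hat_letter L1 <• #beta1) *
  (hat_basis R0 = hat_letter R0 <• 1) * (hat_basis R1 = hat_letter R1 <• #beta2).
Proof. by rewrite /hat_basis !(tnth_nth (hat_letter L0)) !ract1. Qed.

(** The wreath recursion of [A], [B], [C] in the basis [hat_basis]. *)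
Lemma hatA_recursion :
  [/\ hatA •> hat_basis L0 = hat_basis L1 <• (hatB * hatA),
      hatA •> hat_basis L1 = hat_basis L0 <• (hatA * hatB),
      hatA •> hat_basis R0 = hat_basis R1 <• 1 &
      hatA •> hat_basis R1 = hat_basis R0 <• 1].
Proof.
have [[a1 a2 b1 b2 b12] _] := hat_relations.
rewrite !hat_basisE /hatA !hat_lactE /= !swapEs !big_cons !big_nil !mulg1 -!ractM.
rewrite !mul1g !mulg1 /hatB; split=> //.
- by rewrite -!mulgA (mulgA #beta1) b1 mul1g.
- by rewrite b12 !mulgA.
- by rewrite b2.
Qed.

Lemma hatB_recursion :
  [/\ hatB •> hat_basis L0 = hat_basis L0 <• hatA,
      hatB •> hat_basis L1 = hat_basis L1 <• (hatC * hatA * hatB),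
      hatB •> hat_basis R0 = hat_basis R0 <• (hatC * hatA * hatB) &
      hatB •> hat_basis R1 = hat_basis R1 <• hatA].
Proof.
have [[a1 a2 b1 b2 b12] _] := hat_relations.
rewrite -alpha1E /hatB !lactM !hat_basisE !hat_lactE /= !perm1 /=.
rewrite !big_cons !big_nil !mulg1 !mul1g -!ractM !mul1g.
by split=> //; rewrite -!mulgA ?b1 ?b2 mulg1.
Qed.

Lemma hatC_recursion :
  [/\ hatC •> hat_basis L0 = hat_basis L0 <• hatC,
      hatC •> hat_basis L1 = hat_basis L1 <• hatB,
      hatC •> hat_basis R0 = hat_basis R0 <• hatC &
      hatC •> hat_basis R1 = hat_basis R1 <• hatB].
Proof.
have [[a1 a2 b1 b2 b12] _] := hat_relations.
rewrite /hatC !lactM !hat_basisE !hat_lactE /= !perm1 /=.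
rewrite !big_cons !big_nil !mulg1 -!ractM !mul1g /hatB.
split=> //.
- by rewrite -b12.
- by rewrite b2 mulg1 b12 !mulgA b2 mul1g.
Qed.

Definition H_gens : set Ghat := [set hatA; hatB; hatC]%classic.
Definition H := gen_group H_gens.

Definition A : H := to_gen (or_introl (or_introl erefl) : H_gens hatA).
Definition B : H := to_gen (or_introl (or_intror erefl) : H_gens hatB).
Definition C : H := to_gen (or_intror erefl : H_gens hatC).

Lemma H_left_invariant : left_invariant_span H hat_basis.
Proof.
have [A0 A1 A2 A3] := hatA_recursion.
have [B0 B1 B2 B3] := hatB_recursion.
have [C0 C1 C2 C3] := hatC_recursion.
apply: gen_left_invariant => s; case=> [[->|->]|->].
- exists swap, (tnth [tuple B * A; A * B; 1; 1]); elim/I4_ind;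
    by rewrite swapEs (tnth_nth 1).
- exists 1%g, (tnth [tuple A; C * A * B; C * A * B; A]); elim/I4_ind;
    by rewrite perm1 (tnth_nth 1).
exists 1%g, (tnth [tuple C; B; C; B]); elim/I4_ind;
  by rewrite perm1 (tnth_nth 1).
Qed.

(** The biset is [{hat_basis i}.H], inside the biset of [Ghat]. *)
Definition H_selfsimilar : selfsimilar :=
  span_selfsimilar (@wreath_free _ _ hat_rec) H_left_invariant.

(** The basis element lying over the letter [i]. *)
Definition H_basis (i : 'I_4) : ss_biset H_selfsimilar :=
  span_elt H_left_invariant i.

Definition x1 := H_basis L0.
Definition x2 := H_basis L1.
Definition x3 := H_basis R0.
Definition x4 := H_basis R1.

(** * Affine transformations, acting from the right *)

Section Affine.
Variable F : fieldType.
Local Open Scope ring_scope.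

(** The pair [(a, b)] is the transformation [z |-> a * z + b]. *)
Definition affine := {p : F * F | p.1 != 0}.

Definition Affine (a b : F) (a0 : a != 0) : affine :=
  exist (fun p : F * F => is_true (p.1 != 0)) (a, b) a0.

Definition slope (f : affine) : F := (val f).1.
Definition translation (f : affine) : F := (val f).2.
Definition apply_affine (z : F) (f : affine) : F := slope f * z + translation f.

Lemma slope_neq0 f : slope f != 0. Proof. exact: valP f. Qed.

HB.instance Definition _ := Choice.on affine.

Lemma affine_eq f g :
  slope f = slope g -> translation f = translation g -> f = g.
Proof.
by case: f g => [[a b] p] [[c e] q]; rewrite /slope /translation /= => ac be;
  apply: val_inj; rewrite /= ac be.
Qed.

Definition affine_one := Affine 0 (oner_neq0 F).
(** Transformations act from the right: [f * g] applies [f] first; see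
    [apply_affineM]. *)
Definition affine_mul (f g : affine) :=
  Affine (slope g * translation f + translation g)
    (mulf_neq0 (slope_neq0 g) (slope_neq0 f)).
Definition affine_inv (f : affine) :=
  Affine (- (slope f)^-1 * translation f) (invr_neq0 (slope_neq0 f)).

Lemma slope_mul f g : slope (affine_mul f g) = slope g * slope f.
Proof. by []. Qed.
Lemma translation_mul f g :
  translation (affine_mul f g) = slope g * translation f + translation g.
Proof. by []. Qed.

Lemma affine_mulA : associative affine_mul.
Proof.
move=> f g h; apply: affine_eq; rewrite !(slope_mul, translation_mul) ?mulrA //.
by rewrite mulrDr mulrA addrA.
Qed.
Lemma affine_mul1 : left_id affine_one affine_mul.
Proof.
move=> f; apply: affine_eq; rewrite !(slope_mul, translation_mul) ?mulr1 //.
by rewrite mulr0 add0r.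
Qed.
Lemma affine_1mul : right_id affine_one affine_mul.
Proof.
move=> f; apply: affine_eq; rewrite !(slope_mul, translation_mul) ?mul1r //.
by rewrite addr0.
Qed.
Lemma affine_mulV : left_inverse affine_one affine_inv affine_mul.
Proof.
move=> f; have f0 := slope_neq0 f.
apply: affine_eq; rewrite !(slope_mul, translation_mul); first exact: divff.
rewrite (_ : translation (affine_inv f) = - (slope f)^-1 * translation f) //.
by rewrite mulNr mulrN mulrA divff // mul1r addNr.
Qed.
Lemma affine_Vmul : right_inverse affine_one affine_inv affine_mul.
Proof.
move=> f; have f0 := slope_neq0 f.
apply: affine_eq; rewrite !(slope_mul, translation_mul); first exact: mulVf.
rewrite (_ : translation (affine_inv f) = - (slope f)^-1 * translation f) //.
by rewrite mulNr addrN.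
Qed.

HB.instance Definition _ :=
  isGroup.Build affine affine_mulA affine_mul1 affine_1mul affine_mulV affine_Vmul.

Lemma apply_affineM z (f g : affine) :
  apply_affine z (f * g)%g = apply_affine (apply_affine z f) g.
Proof.
by rewrite /apply_affine slope_mul translation_mul mulrDr -addrA mulrA addrA.
Qed.

Lemma apply_affine_inj (f g : affine) :
  (forall z, apply_affine z f = apply_affine z g) -> f = g.
Proof.
rewrite /apply_affine => fg; have := fg 0; rewrite !mulr0 !add0r => e.
by apply: affine_eq => //; have := fg 1; rewrite !mulr1 e => /addIr.
Qed.

End Affine.

Notation "z ◁ f" := (apply_affine z f) (at level 40, left associativity).

Section GaussianAffine.
Variable R : realType.
Local Open Scope ring_scope.

Definition gaussian_int : {pred R[i]} :=
  [pred q | (complex.Re q \is a Num.int) && (complex.Im q \is a Num.int)].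

(** The transformations [z |-> ± z + q] with [q] in [Z[i]]. *)
Definition pm_pred : {pred affine R[i]} :=
  [pred f | ((slope f == 1) || (slope f == - 1)) &&
            (translation f \in gaussian_int)].

Lemma gaussianE (m n : int) :
  m%:~R + 'i * n%:~R = (m%:~R +i* n%:~R)%C :> R[i].
Proof. by rewrite [RHS]complexE -!(rmorph_int (real_complex R)). Qed.

Lemma gaussianP q : reflect (exists m n : int, q = m%:~R + 'i * n%:~R)
  (q \in gaussian_int).
Proof.
apply: (iffP andP) => [[/intrP [m em] /intrP [n en]]|[m [n ->]]].
  by exists m, n; rewrite gaussianE -em -en; case: (q).
by rewrite gaussianE /= !intr_int.
Qed.

Lemma gaussianB p q :
  p \in gaussian_int -> q \in gaussian_int -> p - q \in gaussian_int.
Proof.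
case: p q => [a b] [c e] /andP [/= ha hb] /andP [/= hc he].
by apply/andP; rewrite /= !rpredB.
Qed.

Lemma gaussian0 : 0 \in gaussian_int.
Proof. by apply/andP; rewrite /= !rpred0. Qed.

Lemma gaussianN p : p \in gaussian_int -> - p \in gaussian_int.
Proof. by rewrite -[- p]sub0r; apply: gaussianB; apply: gaussian0. Qed.

Lemma gaussianD p q :
  p \in gaussian_int -> q \in gaussian_int -> p + q \in gaussian_int.
Proof. by move=> pG qG; rewrite -[q]opprK; apply/gaussianB/gaussianN. Qed.

Lemma pm_closed : group_closed pm_pred.
Proof.
split; first by rewrite inE /= eqxx /= gaussian0.
move=> f g /andP [f1 fG] /andP [g1 gG].
have E : translation (f * g^-1)%g =
  (slope g)^-1 * translation f + - (slope g)^-1 * translation g by [].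
rewrite inE E (_ : slope (f * g^-1)%g = (slope g)^-1 * slope f) //.
case/orP: g1 => /eqP ->; case/orP: f1 => /eqP ->;
  rewrite ?(invrN, invr1) ?(mulN1r, mul1r, opprK) ?eqxx ?orbT /=;
  by rewrite ?gaussianB // addrC gaussianB.
Qed.

Definition pm_affine := {f : affine R[i] | f \in pm_pred}.

HB.instance Definition _ := SubChoice.on pm_affine.
HB.instance Definition _ :=
  SubChoice_isSubGroup.Build (affine R[i]) (fun f => f \in pm_pred) pm_affine
    pm_closed.

Lemma onePi_neq0 : 1 + 'i != 0 :> R[i].
Proof. by rewrite eq_complex /= addr0 oner_eq0. Qed.

Lemma onePi_inv_neq0 : (1 + 'i)^-1 != 0 :> R[i].
Proof. by rewrite invr_eq0 onePi_neq0. Qed.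

Lemma oneMi_inv_neq0 : (1 - 'i)^-1 != 0 :> R[i].
Proof. by rewrite invr_eq0 eq_complex /= oppr0 addr0 oner_eq0. Qed.

Lemma onePi_invN_neq0 : - (1 + 'i)^-1 != 0 :> R[i].
Proof. by rewrite oppr_eq0 onePi_inv_neq0. Qed.

Lemma oneMi_invN_neq0 : - (1 - 'i)^-1 != 0 :> R[i].
Proof. by rewrite oppr_eq0 oneMi_inv_neq0. Qed.

Definition affine_basis (i : 'I_4) : regular_biset (affine R[i]) :=
  tnth [tuple Affine 0 onePi_inv_neq0;
              Affine ((1 + 'i)^-1 * 'i) onePi_invN_neq0;
              Affine 0 oneMi_inv_neq0;
              Affine (1 - 'i)^-1 oneMi_invN_neq0] i.

Lemma gaussian_onePi q : q \in gaussian_int ->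
  (1 + 'i)^-1 * q \in gaussian_int \/
  (1 + 'i)^-1 * (q + 'i) \in gaussian_int /\
  (1 + 'i)^-1 * (q - 'i) \in gaussian_int.
Proof.
have ii : 'i * 'i = -1 :> R[i] by rewrite -[LHS]expr2 sqr_i.
have div (p r : R[i]) : (1 + 'i) * r = p -> (1 + 'i)^-1 * p = r.
  by move=> <-; rewrite mulKf // onePi_neq0.
have E (m k : int) : (1 + 'i)^-1 * (m%:~R + 'i * (2 * k - m)%:~R) =
    k%:~R + 'i * (k - m)%:~R :> R[i].
  apply: div; rewrite !rmorphB rmorphM /=; ring: ii.
case/gaussianP => m [n ->].
have [k [->|->]] : exists k : int, n = 2 * k - m \/ n = 2 * k + 1 - m.
  by exists ((m + n) %/ 2)%Z; lia.
  by left; rewrite E; apply/gaussianP; exists k, (k - m).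
right; split.
  rewrite (_ : m%:~R + 'i * (2 * k + 1 - m)%:~R + 'i = m%:~R + 'i * (2 * (k + 1) - m)%:~R).
    by rewrite E; apply/gaussianP; exists (k + 1), (k + 1 - m).
  by rewrite !(rmorphB, rmorphD, rmorphM) /=; ring.
rewrite (_ : m%:~R + 'i * (2 * k + 1 - m)%:~R - 'i = m%:~R + 'i * (2 * k - m)%:~R).
  by rewrite E; apply/gaussianP; exists k, (k - m).
by rewrite !(rmorphB, rmorphD, rmorphM) /=; ring.
Qed.

Lemma gaussian_oneMi q : q \in gaussian_int ->
  (1 - 'i)^-1 * q \in gaussian_int \/
  (1 - 'i)^-1 * (q + 1) \in gaussian_int /\
  (1 - 'i)^-1 * (q - 1) \in gaussian_int.
Proof.
have ii : 'i * 'i = -1 :> R[i] by rewrite -[LHS]expr2 sqr_i.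
have e : (1 - 'i)^-1 = (1 + 'i)^-1 * 'i :> R[i].
  have n0 : 1 - 'i != 0 :> R[i] by have := oneMi_inv_neq0; rewrite invr_eq0.
  apply: (mulfI n0); rewrite divff // mulrCA.
  rewrite (_ : (1 - 'i) * 'i = 1 + 'i) ?mulVf ?onePi_neq0 //.
  by ring: ii.
move=> /gaussianP [m [n qE]].
have iq : 'i * q \in gaussian_int.
  by apply/gaussianP; exists (- n), m; rewrite qE rmorphN /=; ring: ii.
rewrite e -!mulrA mulrDr mulrBr mulr1.
exact: gaussian_onePi.
Qed.

Lemma pm_make (e q : R[i]) : (e = 1) \/ (e = -1) -> q \in gaussian_int ->
  exists k : pm_affine, slope (val k) = e /\ translation (val k) = q.
Proof.
move=> e1 qG; have e0 : e != 0.
  by case: e1 => ->; rewrite ?oppr_eq0 oner_eq0.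
have kP : Affine q e0 \in pm_pred.
  by rewrite inE /slope /translation /= qG andbT; case: e1 => ->; rewrite eqxx ?orbT.
by exists (exist (fun f => is_true (f \in pm_pred)) _ kP).
Qed.

Lemma affine_basisE :
  [/\ affine_basis L0 = Affine 0 onePi_inv_neq0,
      affine_basis L1 = Affine ((1 + 'i)^-1 * 'i) onePi_invN_neq0,
      affine_basis R0 = Affine 0 oneMi_inv_neq0 &
      affine_basis R1 = Affine (1 - 'i)^-1 oneMi_invN_neq0].
Proof.
by rewrite /affine_basis !(tnth_nth (Affine 0 onePi_inv_neq0)).
Qed.

Lemma affine_span_aux (w c : R[i]) (i j : 'I_4) (f : affine R[i]) (e q : R[i]) :
  slope (affine_basis i) = w -> translation (affine_basis i) = 0 ->
  slope (affine_basis j) = - w -> translation (affine_basis j) = w * c ->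
  w * q \in gaussian_int \/
    w * (q + c) \in gaussian_int /\ w * (q - c) \in gaussian_int ->
  (e = 1) \/ (e = -1) -> slope f = w * e -> translation f = w * q ->
  span pm_affine affine_basis f.
Proof.
move=> si ti sj tj qG e1 sf tf; case: qG => [qG|[qP qM]].
  have [k [sk tk]] := pm_make e1 qG.
  exists i, k; apply: affine_eq; rewrite ?slope_mul ?translation_mul.
    by rewrite sf sk si mulrC.
  by rewrite tf tk ti mulr0 add0r.
have qG : w * (q + e * c) \in gaussian_int.
  by case: e1 => ->; rewrite ?mul1r ?mulN1r.
have e1' : (- e = 1) \/ (- e = -1).
  by case: e1 => ->; [right|left]; rewrite ?opprK.
have [k [sk tk]] := pm_make e1' qG.
exists j, k; apply: affine_eq; rewrite ?slope_mul ?translation_mul.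
  by rewrite sf sk sj mulrNN mulrC.
by rewrite tf tk sk tj; ring.
Qed.

Lemma affine_left_invariant : left_invariant_span pm_affine affine_basis.
Proof.
have [b0 b1 b2 b3] := affine_basisE.
move=> k; have /andP [k1 kG] := valP k.
have e1 : slope (val k) = 1 \/ slope (val k) = -1.
  by case/orP: k1 => /eqP; [left|right].
have e1' : - slope (val k) = 1 \/ - slope (val k) = -1.
  by case: e1 => ->; [right|left]; rewrite ?opprK.
have iG : 'i \in gaussian_int.
  by apply/gaussianP; exists 0, 1; rewrite mulr1 add0r.
have oneG : 1 \in gaussian_int.
  by apply/gaussianP; exists 1, 0; rewrite mulr0 addr0.
have sl i : slope (\val k •> affine_basis i) = slope (affine_basis i) * slope (val k).
  by [].
have tl i : translation (\val k •> affine_basis i) =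
  slope (affine_basis i) * translation (val k) + translation (affine_basis i) by [].
elim/I4_ind.
- apply: (@affine_span_aux (1 + 'i)^-1 'i L0 L1 _ (slope (val k)) (translation (val k)));
    rewrite ?sl ?tl ?b0 ?b1 ?addr0 //; exact: gaussian_onePi.
- apply: (@affine_span_aux (1 + 'i)^-1 'i L0 L1 _ (- slope (val k)) ('i - translation (val k)));
    rewrite ?sl ?tl ?b0 ?b1 //.
  + by apply/gaussian_onePi/gaussianB.
  + by rewrite [slope _]/= mulrN mulNr.
  + by rewrite [slope _]/= [translation (Affine _ _)]/= mulrBr mulNr addrC.
- apply: (@affine_span_aux (1 - 'i)^-1 1 R0 R1 _ (slope (val k)) (translation (val k)));
    rewrite ?sl ?tl ?b2 ?b3 ?addr0 ?mulr1 //; exact: gaussian_oneMi.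
- apply: (@affine_span_aux (1 - 'i)^-1 1 R0 R1 _ (- slope (val k)) (1 - translation (val k)));
    rewrite ?sl ?tl ?b2 ?b3 ?mulr1 //.
  + by apply/gaussian_oneMi/gaussianB.
  + by rewrite [slope _]/= mulrN mulNr.
  + by rewrite [slope _]/= [translation (Affine _ _)]/= mulrBr mulr1 mulNr addrC.
Qed.

(** The group of all [z |-> ± z + q] with the biset of affine transformations
    [{affine_basis i}.pm_affine]; both actions are composition in [affine]. *)
Definition affine_selfsimilar : selfsimilar :=
  span_selfsimilar (@regular_free (affine R[i])) affine_left_invariant.

Definition affine_of_group (g : affine_selfsimilar) : affine R[i] := val g.

Definition affine_of_biset (m : ss_biset affine_selfsimilar) : affine R[i] :=
  sval m.

End GaussianAffine.

(* Main.v *)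
Require Import Defs.
From HB Require Import structures.
From mathcomp Require Import all_boot all_order all_fingroup all_algebra.
From mathcomp Require Import boolp classical_sets reals complex.
From mathcomp Require Import zify ring.

Set Implicit Arguments.
Unset Strict Implicit.
Unset Printing Implicit Defensive.

Import Order.TTheory GRing.Theory Num.Theory.
Local Open Scope ring_scope.

(** A self-similar group in which only the identity acts trivially on all
    levels of the tree is determined by the wreath recursion of its generators.
    Indeed, let [A, B, C] in [H] and [a, b, c] in the affine group satisfy the
    same recursion, and let [Q] be the subgroup of the product generated by
    [(A, a)], [(B, b)], [(C, c)]. Sections of a pair in [Q] at a common basis
    element lie again in [Q]. Hence if [(g, 1)] is in [Q], then [g] fixes every
    basis element and its sections are again such elements, so [g] acts
    trivially on the tree and [g = 1]; symmetrically [(1, f)] in [Q] forces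
    [f = 1]. So [Q] is the graph of a group isomorphism, which extends to
    the bisets by sending basis to basis ([ss_iso_corr]).

    It remains to see that both groups have this faithfulness property and that
    [a, b, c] generate. For [H] faithfulness is that of the action on words,
    transported to the basis by conjugation ([wreath_section_faithful]). For
    the affine group, the section of [z |-> e z + q] at [x1] is
    [z |-> e z + q / (1 + i)]; an element of the kernel of the action therefore
    has [q] divisible by every power of [1 + i], so [q = 0], by descent on the
    norm ([fixing_gtrans0]). The section of [z |-> -z] at [x2] has translation
    part [1 + i], which excludes the sign [-1] ([fixing_eq1]). Generation is
    clear: [c a] and [c b] are the translations by [1] and [1 + i].

    The two summands of the biset are told apart by the square of the slope,
    which neither action changes: it is [(1 + i)^-2] on the summand of
    [x1, x2] and [(1 - i)^-2] on the other one. *)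

(** * Self-similar groups with the same wreath recursion *)

Section SameRecursion.
Local Open Scope group_scope.

(** Triviality of the kernel of the action on the tree, coinductively: that
    kernel is the largest set of elements that fix all basis elements and whose
    sections belong to the set again. *)
Definition section_faithful (S : selfsimilar) n (b : 'I_n -> ss_biset S) :=
  forall K : set S,
    (forall g i, K g -> exists2 h, K h & g •> b i = b i <• h) ->
    forall g, K g -> g = 1.

Definition division_closed (S T : groupType) (Q : S -> T -> Prop) :=
  forall g g' f f', Q g f -> Q g' f' -> Q (g * g'^-1) (f * f'^-1).

(** The permutation is part of the data so that inverses obey a recursion too:
    the section of [g^-1] at [i] is read off from that of [g] at [p^-1 i]. *)
Definition same_recursion (S T : selfsimilar) n (b : 'I_n -> ss_biset S)
    (b' : 'I_n -> ss_biset T) (Q : S -> T -> Prop) g f :=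
  exists p : 'S_n, forall i, exists h k,
    [/\ g •> b i = b (p i) <• h, f •> b' i = b' (p i) <• k & Q h k].

Lemma ract_inj (S : selfsimilar) (m : ss_biset S) : injective (fun g => m <• g).
Proof.
move=> g h /= e; apply: divg1_eq; apply: (@ss_free S m).
by rewrite ractM e -ractM mulgV ract1.
Qed.

Lemma basis_inj (G : groupType) (M : biset G) n (b : 'I_n -> M) i j g h :
  is_basis b -> b i <• g = b j <• h -> i = j.
Proof.
by move=> /(_ (b i <• g)) [k [_ u]] e; rewrite -(u i) ?(u j) //; [exists h|exists g].
Qed.

Lemma lactV_basis (G : groupType) (M : biset G) (m m' : M) g h :
  g •> m = m' <• h -> g^-1 •> m' = m <• h^-1.
Proof.
move=> e; rewrite -[m'](ract1 (b:=M)) -(mulgV h) ractM -e -lractA -lactM.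
by rewrite mulVg lact1.
Qed.

Lemma same_recursion_div (S T : selfsimilar) n (b : 'I_n -> ss_biset S)
    (b' : 'I_n -> ss_biset T) (Q : S -> T -> Prop) :
  division_closed Q -> division_closed (same_recursion b b' Q).
Proof.
move=> Qd x y u v [p pP] [q qP]; exists (q^-1 * p)%g => i.
have [h [k [e1 e2 Qhk]]] := pP (q^-1 i)%g.
have [h' [k' [e1' e2' Qhk']]] := qP (q^-1 i)%g.
exists (h * h'^-1), (k * k'^-1); rewrite permM permKV in e1' e2' *.
rewrite !lactM (lactV_basis e1') (lactV_basis e2') -!lractA e1 e2 -!ractM.
by split=> //; apply: Qd.
Qed.

Section Correspondence.
Variables (S T : selfsimilar) (n : nat).
Variables (b : 'I_n -> ss_biset S) (b' : 'I_n -> ss_biset T).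
Variable Q : S -> T -> Prop.
Hypotheses (bP : is_basis b) (bP' : is_basis b').
Hypotheses (Qd : division_closed Q).
Hypothesis Qrec : forall g f, Q g f -> same_recursion b b' Q g f.

(** If [(g, f)] and [(g', f)] are in [Q], then so is [(g / g', 1)]. Elements
    corresponding to [1] fix the basis, since their partner does, and their
    sections correspond to sections of [1]; faithfulness makes them trivial. *)
Lemma corr_injective : section_faithful b ->
  forall g g' f, Q g f -> Q g' f -> g = g'.
Proof.
move=> faith g g' f Qg Qg'; apply: divg1_eq.
apply: (faith (Q^~ 1)); last by rewrite /= -(mulgV f); apply: Qd.
move=> u i /Qrec [p /(_ i) [h [k [e1 e2 Qhk]]]].
rewrite lact1 -[X in X = _](ract1 (b:=ss_biset T)) in e2.
have ip := basis_inj bP' e2; rewrite -ip in e1 e2.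
by have k1 := ract_inj e2; exists h; rewrite // k1.
Qed.

Lemma basis_map (phi : S -> T) :
  exists psi : ss_biset S -> ss_biset T,
    forall i g, psi (b i <• g) = b' i <• phi g.
Proof.
have ex m : exists m', exists i g, m = b i <• g /\ m' = b' i <• phi g.
  by have [i [[g ->] _]] := bP m; exists (b' i <• phi g), i, g.
exists (fun m => sval (cid (ex m))) => i g.
case: (cid _) => m' /= [j [h [e ->]]].
have ij := basis_inj bP e; rewrite -ij in e *.
by rewrite (ract_inj e).
Qed.
End Correspondence.

(** The hypotheses are symmetric in [S] and [T], so [corr_injective] applies to
    [Q] and to its converse, and [Q] is the graph of a bijection. *)
Theorem ss_iso_corr (S T : selfsimilar) n (b : 'I_n -> ss_biset S)
    (b' : 'I_n -> ss_biset T) (Q : S -> T -> Prop) :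
  is_basis b -> is_basis b' -> section_faithful b -> section_faithful b' ->
  division_closed Q -> (forall g f, Q g f -> same_recursion b b' Q g f) ->
  (forall g, exists f, Q g f) -> (forall f, exists g, Q g f) ->
  exists F : ss_iso S T,
    (forall g f, Q g f -> iso_group F g = f) /\ forall i, iso_biset F (b i) = b' i.
Proof.
move=> bP bP' faith faith' Qd Qrec /choice [phi phiP] /choice [phi' phiP'].
pose Q' f g := Q g f.
have Qd' : division_closed Q' by move=> f f' g g'; apply: Qd.
have Qrec' f g : Q' f g -> same_recursion b' b Q' f g.
  move=> /Qrec [p pP]; exists p => i; have [h [k [e1 e2 q]]] := pP i.
  by exists k, h.
have Qinj := corr_injective bP' Qd Qrec faith.
have Qfun := corr_injective bP Qd' Qrec' faith'.
have phiE g f : Q g f -> phi g = f by move=> q; apply: Qfun (phiP g) q.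
have Q1 : Q 1 1 by rewrite -(mulgV 1) -(mulgV (phi 1)); apply: Qd.
have phiM : {morph phi : g h / g * h}.
  move=> g h; apply: phiE.
  by have := Qd _ _ _ _ (phiP g) (Qd _ _ _ _ Q1 (phiP h)); rewrite !mul1g !invgK.
have phiK : cancel phi phi' by move=> g; apply: Qinj (phiP' _) (phiP _).
have phiK' : cancel phi' phi by move=> f; apply: Qfun (phiP _) (phiP' _).
have [psi psiE] := basis_map b' bP phi.
have [psi' psiE'] := basis_map b bP' phi'.
have psi_bij : bijective psi.
  exists psi' => m; [have [i [[g ->] _]] := bP m|have [i [[g ->] _]] := bP' m].
    by rewrite psiE psiE' phiK.
  by rewrite psiE' psiE phiK'.
have psiM g m h : psi (g •> m <• h) = phi g •> psi m <• phi h.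
  have [i [[k ->] _]] := bP m.
  have [p /(_ i) [g' [k' [e1 e2 q]]]] := Qrec _ _ (phiP g).
  rewrite psiE -!lractA e1 e2 -!ractM psiE !phiM.
  by rewrite (phiE _ _ q).
have phi_bij : bijective phi by exists phi'.
exists (SSIso phiM phi_bij psi_bij psiM); split=> [g f /phiE //|i] /=.
rewrite -[b i](ract1 (b:=ss_biset S)) psiE (_ : phi 1 = 1) ?ract1 //.
exact: phiE.
Qed.

Lemma generated_iso (S T : selfsimilar) (F : ss_iso S T) (U : set (ss_biset S))
    (V : set (ss_biset T)) m :
  (forall u, U u -> V (iso_biset F u)) ->
  generated_biset U m -> generated_biset V (iso_biset F m).
Proof.
move=> UV [g [u [h [Uu ->]]]]; exists (iso_group F g), (iso_biset F u), (iso_group F h).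
by split; [exact: UV|exact: iso_bisetM].
Qed.

Lemma generated_subbiset (G : groupType) (M : biset G) (U : set M) :
  is_subbiset (generated_biset U).
Proof.
split=> [g _ [h [s [k [Us ->]]]]|_ g [h [s [k [Us ->]]]]].
  by exists (g * h), s, k; rewrite lactM !lractA.
by exists h, s, (k * g); rewrite ractM.
Qed.

Lemma generated_cover (G : groupType) (M : biset G) (b : 'I_4 -> M) :
  is_basis b ->
  (generated_biset [set b L0; b L1] `|` generated_biset [set b R0; b R1])%classic
    = [set: M]%classic.
Proof.
move=> bP; apply/seteqP; split=> // m _.
have gen (U : set M) i g : U (b i) -> generated_biset U (b i <• g).
  by move=> Ui; exists 1%g, (b i), g; rewrite lact1.
have [i [[g ->] _]] := bP m.
by move: i; elim/I4_ind; [left|left|right|right]; apply: gen; [left|right|left|right].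
Qed.

Lemma size_tree_aut d (g : tree_aut d) v : size (g v) = size v.
Proof.
elim/last_ind: v => [|v x IH]; first by rewrite tfun_root.
by have [y ->] := tfun_child g v x; rewrite !size_rcons IH.
Qed.

(** The basis [(i, c i)] differs from the standard one by the shifts [c i], so
    that the section of [g] at the letter [i] is the conjugate by [c i] of its
    section [h] in this basis. As automorphisms preserve word length, an
    induction on the length shows that all words are fixed. *)
Lemma wreath_section_faithful d (I : Type) (rec : I -> 'S_d * d.-tuple (seq I))
    (c : 'I_d -> wreath_group rec) (K : set (wreath_group rec)) :
  (forall g i, K g -> exists2 h, K h &
     g •> ((i, c i) : wreath_biset rec) = ((i, c i) : wreath_biset rec) <• h) ->
  forall g, K g -> g = 1.
Proof.
move=> Krec g Kg; apply: val_inj; apply: tree_aut_ext => v.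
elim: {v}(size v) {-2}v (erefl (size v)) g Kg => [|n IH] [|x v] // sv g Kg.
  by rewrite /= !tfun_root.
case: sv => sv.
have [h Kh e] := Krec g x Kg.
have e1 : letter (\val g) x = x := congr1 fst e.
have e2 : wreath_sect g x * c x = c x * h := congr1 snd e.
have sE : section (\val g) x = \val (c x * h * (c x)^-1) by rewrite -e2 mulgK.
rewrite tree_section e1 sE !gmulfM gmulfV !tree_mulE (IH _ _ h Kh).
  by congr (_ :: _); rewrite [LHS](tinvK (\val (c x))).
by rewrite size_tree_aut.
Qed.
End SameRecursion.

(** * The group H *)

Section GroupH.
Local Open Scope group_scope.

Definition basis_shift : 'I_4 -> Ghat :=
  tnth [tuple 1; wreath_gen hat_rec beta1; 1; wreath_gen hat_rec beta2].

Lemma hat_basis_pair i : hat_basis i = ((i, basis_shift i) : Ghat_biset).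
Proof.
elim/I4_ind: i; rewrite hat_basisE /basis_shift (tnth_nth 1) /=;
  by congr pair; rewrite mul1g.
Qed.

(** Elements of distinct right orbits lie over distinct letters. *)
Lemma H_is_basis : is_basis H_basis.
Proof.
move=> [m pm]; have [i [k e]] := pm; exists i; split; first by exists k; apply: spanE.
move=> j [k' /(congr1 sval) /=]; rewrite e !hat_basis_pair.
by move=> /(congr1 fst).
Qed.

Lemma H_section_faithful : section_faithful (S := H_selfsimilar) H_basis.
Proof.
move=> K Krec g Kg; apply: val_inj; rewrite gmulf1.
apply: (@wreath_section_faithful _ _ hat_rec basis_shift [set \val k | k in K]%classic).
  move=> _ i [k Kk <-]; have [h Kh /(congr1 sval) e] := Krec k i Kk.
  by exists (\val h); [exists h|rewrite -/Ghat_biset -hat_basis_pair].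
by exists g.
Qed.

(** The recursion in the biset of [Ghat] restricts to the biset of [H]. *)
Lemma A_recursion :
  [/\ A •> x1 = x2 <• (B * A), A •> x2 = x1 <• (A * B),
      A •> x3 = x4 <• 1 & A •> x4 = x3 <• 1].
Proof. by have [? ? ? ?] := hatA_recursion; split; apply: spanE. Qed.

Lemma B_recursion :
  [/\ B •> x1 = x1 <• A, B •> x2 = x2 <• (C * A * B),
      B •> x3 = x3 <• (C * A * B) & B •> x4 = x4 <• A].
Proof. by have [? ? ? ?] := hatB_recursion; split; apply: spanE. Qed.

Lemma C_recursion :
  [/\ C •> x1 = x1 <• C, C •> x2 = x2 <• B, C •> x3 = x3 <• C & C •> x4 = x4 <• B].
Proof. by have [? ? ? ?] := hatC_recursion; split; apply: spanE. Qed.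

Lemma H_ind (P : H -> Prop) : P 1 -> (forall g h, P g -> P h -> P (g * h^-1)) ->
  P A -> P B -> P C -> forall g, P g.
Proof.
move=> P1 Pd PA PB PC g.
suff: exists2 h : H, P h & \val h = \val g by case=> h Ph /val_inj <-.
move: (\val g) (valP g); apply: gen_ind => [|x y [h Ph <-] [k Pk <-]|s].
- by exists 1; rewrite ?gmulf1.
- by exists (h * k^-1); [apply: Pd|rewrite gmulfF].
by case=> [[->|->]|->]; [exists A|exists B|exists C].
Qed.
End GroupH.

(** * The affine group *)

Section AffineGroup.
Variable R : realType.
Local Notation T := (affine_selfsimilar R).

Definition aff_basis (i : 'I_4) : ss_biset T := span_elt (@affine_left_invariant R) i.

Lemma sqr_iE : 'i * 'i = -1 :> R[i].
Proof. by rewrite -[LHS]expr2 sqr_i. Qed.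

Lemma two_neq0 : 2 != 0 :> R[i]. Proof. by rewrite pnatr_eq0. Qed.

Lemma onePi_inv : (1 + 'i)^-1 = (1 - 'i) / 2 :> R[i].
Proof.
apply: (mulfI (onePi_neq0 R)); rewrite divff ?onePi_neq0 //.
have n2 := two_neq0; by field: sqr_iE.
Qed.

Lemma oneMi_inv : (1 - 'i)^-1 = (1 + 'i) / 2 :> R[i].
Proof.
have n0 : 1 - 'i != 0 :> R[i] by have := oneMi_inv_neq0 R; rewrite invr_eq0.
apply: (mulfI n0); rewrite divff //.
have n2 := two_neq0; by field: sqr_iE.
Qed.

Lemma half_onePi_nongaussian : (1 + 'i) / 2 \notin @gaussian_int R.
Proof.
apply/negP => /gaussianP [m [n e]].
have : (1%:~R + 'i * 1%:~R)%R = (2 * m)%:~R + 'i * (2 * n)%:~R :> R[i].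
  rewrite !rmorphM /= !mulrA [_ * 2]mulrC -!mulrA -mulrDr -e mulr1.
  by rewrite mulrC divfK ?two_neq0.
by rewrite !gaussianE => /(congr1 (@complex.Re R)) /= /intr_inj; lia.
Qed.

Definition gslope (f : T) : R[i] := slope (affine_of_group f).
Definition gtrans (f : T) : R[i] := translation (affine_of_group f).
Definition bslope (m : ss_biset T) : R[i] := slope (affine_of_biset m).
Definition btrans (m : ss_biset T) : R[i] := translation (affine_of_biset m).

Lemma gslopeP f : gslope f = 1 \/ gslope f = -1.
Proof. by have /andP [/orP [] /eqP] := valP f; [left|right]. Qed.

Lemma gtrans_gaussian f : gtrans f \in @gaussian_int R.
Proof. by have /andP [] := valP f. Qed.

Lemma gaffine_eq f g : gslope f = gslope g -> gtrans f = gtrans g -> f = g.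
Proof. by move=> es et; apply: val_inj; apply: affine_eq. Qed.

Lemma baffine_eq m m' : bslope m = bslope m' -> btrans m = btrans m' -> m = m'.
Proof. by move=> es et; apply: spanE; apply: affine_eq. Qed.

Lemma gslopeM f g : gslope (f * g)%g = gslope g * gslope f.
Proof. by []. Qed.
Lemma gtransM f g : gtrans (f * g)%g = gslope g * gtrans f + gtrans g.
Proof. by []. Qed.
Lemma gslope1 : gslope 1%g = 1. Proof. by []. Qed.
Lemma gtrans1 : gtrans 1%g = 0. Proof. by []. Qed.
Lemma gslopeV f : gslope f^-1%g = (gslope f)^-1.
Proof. by []. Qed.
Lemma gtransV f : gtrans f^-1%g = - (gslope f)^-1 * gtrans f.
Proof. by []. Qed.
Lemma bslope_lact f m : bslope (f •> m) = bslope m * gslope f.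
Proof. by []. Qed.
Lemma btrans_lact f m : btrans (f •> m) = bslope m * gtrans f + btrans m.
Proof. by []. Qed.
Lemma bslope_ract m f : bslope (m <• f) = gslope f * bslope m.
Proof. by []. Qed.
Lemma btrans_ract m f : btrans (m <• f) = gslope f * btrans m + gtrans f.
Proof. by []. Qed.

Lemma aff_basisE :
  [/\ bslope (aff_basis L0) = (1 + 'i)^-1 /\ btrans (aff_basis L0) = 0,
      bslope (aff_basis L1) = - (1 + 'i)^-1 /\ btrans (aff_basis L1) = (1 + 'i) / 2,
      bslope (aff_basis R0) = (1 - 'i)^-1 /\ btrans (aff_basis R0) = 0 &
      bslope (aff_basis R1) = - (1 - 'i)^-1 /\ btrans (aff_basis R1) = (1 + 'i) / 2].
Proof.
have [b0 b1 b2 b3] := affine_basisE R.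
rewrite /bslope /btrans /affine_of_biset /aff_basis /span_elt /= b0 b1 b2 b3.
split; split=> //; rewrite /translation /= ?oneMi_inv // onePi_inv mulrAC; congr (_ / _).
by ring: sqr_iE.
Qed.

Lemma sqr_bslope_lact f m : bslope (f •> m) ^+ 2 = bslope m ^+ 2.
Proof. by rewrite bslope_lact; case: (gslopeP f) => ->; rewrite ?mulrN1 ?sqrrN ?mulr1. Qed.

Lemma sqr_bslope_ract f m : bslope (m <• f) ^+ 2 = bslope m ^+ 2.
Proof. by rewrite bslope_ract; case: (gslopeP f) => ->; rewrite ?mulN1r ?sqrrN ?mul1r. Qed.

(** Together with the square of the slope, integrality of the translation part
    is the invariant that separates the four right orbits. *)
Lemma gaussian_btrans_ract f m :
  (btrans (m <• f) \in @gaussian_int R) = (btrans m \in @gaussian_int R).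
Proof.
have imp g u : btrans u \in @gaussian_int R -> btrans (u <• g) \in @gaussian_int R.
  move=> uG; rewrite btrans_ract; apply: gaussianD (gtrans_gaussian _).
  by case: (gslopeP g) => ->; rewrite ?mulN1r ?mul1r ?gaussianN.
by apply/idP/idP=> [/(imp f^-1%g)|]; [rewrite -ractM mulgV ract1|apply: imp].
Qed.

Lemma sqr_slopes_neq : (1 + 'i)^-1 ^+ 2 != (1 - 'i)^-1 ^+ 2 :> R[i].
Proof.
rewrite onePi_inv oneMi_inv !expr_div_n -subr_eq0 -mulrBl mulf_neq0 //; last first.
  by rewrite invr_eq0 expf_neq0 // two_neq0.
rewrite (_ : _ - _ = - (2 * 2) * 'i); last by ring.
by rewrite mulf_neq0 ?oppr_eq0 ?mulf_neq0 ?two_neq0 // neq0Ci.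
Qed.

Lemma aff_is_basis : is_basis aff_basis.
Proof.
move=> m; have [i [k e]] := svalP m.
exists i; split; first by exists k; apply: spanE.
have -> : m = aff_basis i <• k by apply: spanE.
move=> j [h] {m e}e.
have := sqr_bslope_ract k (aff_basis i); rewrite e sqr_bslope_ract.
have := gaussian_btrans_ract k (aff_basis i); rewrite e gaussian_btrans_ract.
have [[s0 t0] [s1 t1] [s2 t2] [s3 t3]] := aff_basisE.
have nG := negbTE half_onePi_nongaussian.
have sn := sqr_slopes_neq.
move: i j {e}; do 2!elim/I4_ind => //;
  rewrite ?s0 ?s1 ?s2 ?s3 ?t0 ?t1 ?t2 ?t3 ?sqrrN ?nG ?gaussian0 // => _ e;
  by rewrite e eqxx in sn.
Qed.

Section Faithful.
Variable K : set T.
Hypothesis Krec : forall g i, K g -> exists2 h, K h & g •> aff_basis i = aff_basis i <• h.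

(** Descent on the norm: the section [h] of [g] at the first basis element has
    translation part [gtrans g / (1 + i)], whose norm is half that of
    [gtrans g]. *)
Lemma fixing_gtrans0 g : K g -> gtrans g = 0.
Proof.
have [[s0 t0] _ _ _] := aff_basisE.
have /gaussianP [m [n gE]] := gtrans_gaussian g.
have [N mnN] := ubnP `|(m * m + n * n)%R|%N.
elim: N => // N IH in g m n mnN gE * => Kg.
have [h Kh e] := Krec L0 Kg; have /gaussianP [m' [n' hE]] := gtrans_gaussian h.
have := congr1 btrans e; rewrite btrans_lact btrans_ract s0 t0 mulr0 add0r addr0.
move=> /(congr1 ( *%R (1 + 'i))); rewrite mulVKf ?onePi_neq0 // => gh.
have [em en] : m = m' - n' /\ n = m' + n'.
  have : m%:~R + 'i * n%:~R = (m' - n')%:~R + 'i * (m' + n')%:~R :> R[i].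
    by rewrite -gE gh hE !rmorphD rmorphN /=; ring: sqr_iE.
  by rewrite !gaussianE => -[] /intr_inj -> /intr_inj ->.
suff h0 : gtrans h = 0 by rewrite gh h0 mulr0.
(* The norm drops strictly only when [gtrans h] is nonzero. *)
have [z|nz] := eqVneq (gtrans h) 0; first by [].
apply: (IH h m' n' _ hE Kh).
have : ~~ ((m' == 0) && (n' == 0)).
  by apply: contra nz => /andP [/eqP m0 /eqP n0]; rewrite hE m0 n0 mulr0 addr0.
rewrite em en in mnN; nia.
Qed.

(** Both [g] and its section at the second basis element [z |-> - z / (1 + i) + t]
    have translation part [0], so [gslope g] fixes [t], which is nonzero. *)
Lemma fixing_eq1 g : K g -> g = 1%g.
Proof.
move=> Kg; have [_ [s1 t1] _ _] := aff_basisE; have g0 := fixing_gtrans0 Kg.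
apply: gaffine_eq; rewrite ?gtrans1 ?gslope1 //.
have [h Kh e] := Krec L1 Kg; have h0 := fixing_gtrans0 Kh.
have eS := congr1 bslope e; rewrite bslope_lact bslope_ract s1 mulrC in eS.
have n1 : - (1 + 'i)^-1 != 0 :> R[i] by rewrite oppr_eq0 onePi_inv_neq0.
have {}eS := mulIf n1 eS.
have eT := congr1 btrans e.
rewrite btrans_lact btrans_ract h0 g0 mulr0 add0r addr0 t1 -eS in eT.
have n2 : (1 + 'i) / 2 != 0 :> R[i].
  by rewrite mulf_neq0 ?invr_eq0 ?two_neq0 ?onePi_neq0.
by apply: (mulIf n2); rewrite mul1r -eT.
Qed.
End Faithful.

Lemma aff_section_faithful : section_faithful (S := T) aff_basis.
Proof. by move=> K Krec g; apply: fixing_eq1. Qed.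

Local Notation b := aff_basis.

(** * Generators and the correspondence *)

Lemma N1_neq0 : -1 != 0 :> R[i]. Proof. by rewrite oppr_eq0 oner_eq0. Qed.

Lemma half_turn_proof (q : R[i]) : q \in @gaussian_int R -> Affine q N1_neq0 \in @pm_pred R.
Proof. by move=> qG; rewrite inE /slope /translation [_.1]/= eqxx orbT. Qed.

Definition half_turn (q : R[i]) (qG : q \in @gaussian_int R) : T :=
  exist (fun f => is_true (f \in @pm_pred R)) _ (half_turn_proof qG).

Lemma gaussian_1 : 1 \in @gaussian_int R.
Proof. by apply/gaussianP; exists 1, 0; rewrite mulr0 addr0. Qed.
Lemma gaussian_i : 'i \in @gaussian_int R.
Proof. by apply/gaussianP; exists 0, 1; rewrite mulr1 add0r. Qed.

Definition affA : T := half_turn gaussian_1.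
Definition affB : T := half_turn (gaussianD gaussian_1 gaussian_i).
Definition affC : T := half_turn (gaussian0 R).

Lemma aff_genE :
  (gslope affA = -1) * (gtrans affA = 1) * (gslope affB = -1) *
  (gtrans affB = 1 + 'i) * (gslope affC = -1) * (gtrans affC = 0).
Proof. by []. Qed.

(** Reduces identities in the biset to slopes and translation parts, where they
    are rational identities modulo [i ^ 2 = -1]. *)
Local Ltac affine_compute :=
  have [[? ?] [? ?] [? ?] [? ?]] := aff_basisE;
  split; apply: baffine_eq;
  do ?[rewrite bslope_lact | rewrite btrans_lact | rewrite bslope_ract
      | rewrite btrans_ract | rewrite gslopeM | rewrite gtransM
      | rewrite gslope1 | rewrite gtrans1];
  rewrite ?aff_genE;
  repeat match goal with h : bslope _ = _ |- _ => rewrite ?h {h} end;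
  repeat match goal with h : btrans _ = _ |- _ => rewrite ?h {h} end;
  rewrite ?onePi_inv ?oneMi_inv;
  have n2 := two_neq0; by field: sqr_iE.

Lemma affA_recursion :
  [/\ affA •> b L0 = b L1 <• (affB * affA)%g, affA •> b L1 = b L0 <• (affA * affB)%g,
      affA •> b R0 = b R1 <• 1%g & affA •> b R1 = b R0 <• 1%g].
Proof. affine_compute. Qed.

Lemma affB_recursion :
  [/\ affB •> b L0 = b L0 <• affA, affB •> b L1 = b L1 <• (affC * affA * affB)%g,
      affB •> b R0 = b R0 <• (affC * affA * affB)%g & affB •> b R1 = b R1 <• affA].
Proof. affine_compute. Qed.

Lemma affC_recursion :
  [/\ affC •> b L0 = b L0 <• affC, affC •> b L1 = b L1 <• affB,
      affC •> b R0 = b R0 <• affC & affC •> b R1 = b R1 <• affB].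
Proof. affine_compute. Qed.

(** The graph of the isomorphism to be built, as a subgroup of the product:
    [corr_recursion] is then an induction on membership, with no need for words
    in the generators. *)
Inductive corr : H -> T -> Prop :=
| corr1 : corr 1%g 1%g
| corr_div : division_closed corr
| corrA : corr A affA
| corrB : corr B affB
| corrC : corr C affC.

Lemma corrM g g' f f' : corr g f -> corr g' f' -> corr (g * g')%g (f * f')%g.
Proof.
move=> q q'; rewrite -[g']invgK -[f']invgK; apply: corr_div => //.
by rewrite -[(g'^-1)%g]mul1g -[(f'^-1)%g]mul1g; apply: corr_div => //; apply: corr1.
Qed.

Lemma corr_recursion g f : corr g f -> same_recursion H_basis b corr g f.
Proof.
have cab := corrM (corrM corrC corrA) corrB.
elim=> {g f} [|g g' f f' _ Qg _ Qg'||| ].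
- exists 1%g => i; exists 1%g, 1%g; rewrite perm1 !lact1 !ract1.
  by split=> //; apply: corr1.
- exact: (@same_recursion_div H_selfsimilar T _ _ _ _ corr_div _ _ _ _ Qg Qg').
- exists swap; have [a0 a1 a2 a3] := A_recursion; have [b0 b1 b2 b3] := affA_recursion.
  elim/I4_ind; rewrite swapEs.
  + exists (B * A)%g, (affB * affA)%g; split; [exact: a0|exact: b0|exact: (corrM corrB corrA)].
  + exists (A * B)%g, (affA * affB)%g; split; [exact: a1|exact: b1|exact: (corrM corrA corrB)].
  + exists 1%g, 1%g; split; [exact: a2|exact: b2|exact: corr1].
  + exists 1%g, 1%g; split; [exact: a3|exact: b3|exact: corr1].
- exists 1%g; have [a0 a1 a2 a3] := B_recursion; have [b0 b1 b2 b3] := affB_recursion.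
  elim/I4_ind; rewrite perm1.
  + exists A, affA; split; [exact: a0|exact: b0|exact: corrA].
  + exists (C * A * B)%g, (affC * affA * affB)%g; split; [exact: a1|exact: b1|exact: cab].
  + exists (C * A * B)%g, (affC * affA * affB)%g; split; [exact: a2|exact: b2|exact: cab].
  + exists A, affA; split; [exact: a3|exact: b3|exact: corrA].
- exists 1%g; have [a0 a1 a2 a3] := C_recursion; have [b0 b1 b2 b3] := affC_recursion.
  elim/I4_ind; rewrite perm1.
  + exists C, affC; split; [exact: a0|exact: b0|exact: corrC].
  + exists B, affB; split; [exact: a1|exact: b1|exact: corrB].
  + exists C, affC; split; [exact: a2|exact: b2|exact: corrC].
  + exists B, affB; split; [exact: a3|exact: b3|exact: corrB].
Qed.

Lemma corr_total g : exists f, corr g f.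
Proof.
elim/H_ind: g => [|g h [f q] [f' q']|||].
- by exists 1%g; apply: corr1.
- by exists (f * f'^-1)%g; apply: corr_div.
- by exists affA; apply: corrA.
- by exists affB; apply: corrB.
- by exists affC; apply: corrC.
Qed.

Definition corr_translation (t : R[i]) :=
  exists g f, [/\ corr g f, gslope f = 1 & gtrans f = t].

Lemma corr_translationB s t :
  corr_translation s -> corr_translation t -> corr_translation (s - t).
Proof.
move=> [g [f [q sf tf]]] [g' [f' [q' sf' tf']]].
exists (g * g'^-1)%g, (f * f'^-1)%g; split; first exact: corr_div.
  by rewrite gslopeM gslopeV sf sf' invr1 mulr1.
by rewrite gtransM gslopeV gtransV sf' tf tf' invr1 mul1r mulN1r.
Qed.

Lemma corr_translation0 : corr_translation 0.
Proof. by exists 1%g, 1%g; split=> //; apply: corr1. Qed.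

Lemma corr_translationD s t :
  corr_translation s -> corr_translation t -> corr_translation (s + t).
Proof.
move=> qs qt; rewrite -[t]opprK; apply: corr_translationB => //.
by rewrite -sub0r; apply: corr_translationB qt; apply: corr_translation0.
Qed.

Lemma corr_translationMz t (m : int) :
  corr_translation t -> corr_translation (t *~ m).
Proof.
move=> qt; have nat_case n : corr_translation (t *+ n).
  elim: n => [|n IH]; first exact: corr_translation0.
  by rewrite mulrS; apply: corr_translationD.
case: m => n; first exact: nat_case.
by rewrite NegzE mulrNz -sub0r; apply: corr_translationB; [apply: corr_translation0|apply: nat_case].
Qed.

Lemma corr_translation_gaussian t : t \in @gaussian_int R -> corr_translation t.
Proof.
have q1 : corr_translation 1.
  exists (C * A)%g, (affC * affA)%g; split; first exact: (corrM corrC corrA).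
    by rewrite gslopeM !aff_genE mulrNN mulr1.
  by rewrite gtransM !aff_genE mulr0 add0r.
have qB : corr_translation (1 + 'i).
  exists (C * B)%g, (affC * affB)%g; split; first exact: (corrM corrC corrB).
    by rewrite gslopeM !aff_genE mulrNN mulr1.
  by rewrite gtransM !aff_genE mulr0 add0r.
have qi : corr_translation 'i by rewrite -[X in corr_translation X](addKr 1) addrC;
  apply: corr_translationB.
move=> /gaussianP [m [n ->]]; rewrite mulrzr.
by apply: corr_translationD; apply: corr_translationMz.
Qed.

(** An element of slope [-1] becomes a translation when multiplied by [affC]. *)
Lemma corr_onto f : exists g, corr g f.
Proof.
suff pos f' : gslope f' = 1 -> exists g, corr g f'.
  case: (gslopeP f) => [/pos //|sf].
  have [|g q] := pos (f * affC)%g; first by rewrite gslopeM sf aff_genE mulrNN mulr1.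
  exists (g * C^-1)%g; rewrite -[f](mulgK affC).
  by apply: corr_div => //; apply: corrC.
move=> s1; have [g [k [q sk tk]]] := corr_translation_gaussian (gtrans_gaussian f').
by exists g; rewrite (_ : f' = k) //; apply: gaffine_eq; rewrite ?s1 ?tk.
Qed.

Lemma sqr_bslope_generated (U : set (ss_biset T)) w m :
  (forall u, U u -> bslope u ^+ 2 = w) ->
  generated_biset U m -> bslope m ^+ 2 = w.
Proof.
by move=> Uw [g [u [h [/Uw <- ->]]]]; rewrite sqr_bslope_ract sqr_bslope_lact.
Qed.

End AffineGroup.

(** * The isomorphism *)

Lemma aff_disjoint (R : realType) :
  (generated_biset [set aff_basis R L0; aff_basis R L1] `&`
   generated_biset [set aff_basis R R0; aff_basis R R1] = set0)%classic.
Proof.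
have [[s0 _] [s1 _] [s2 _] [s3 _]] := aff_basisE R.
apply/seteqP; split=> // m [m1 m2].
have e1 : bslope m ^+ 2 = (1 + 'i)^-1 ^+ 2.
  by apply: sqr_bslope_generated m1 => u; case=> ->; rewrite ?s0 ?s1 ?sqrrN.
have e2 : bslope m ^+ 2 = (1 - 'i)^-1 ^+ 2.
  by apply: sqr_bslope_generated m2 => u; case=> ->; rewrite ?s2 ?s3 ?sqrrN.
by have := sqr_slopes_neq R; rewrite -e1 e2 eqxx.
Qed.

Theorem proposition4p4 (R : realType) :
  is_basis H_basis /\
  exists f : ss_iso H_selfsimilar (affine_selfsimilar R),
    let phi g := affine_of_group (iso_group f g) in
    let psi m := affine_of_biset (iso_biset f m) in
    [/\ [/\ forall z, z ◁ phi A = - z + 1,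
            forall z, z ◁ phi B = - z + 1 + 'i &
            forall z, z ◁ phi C = - z],
        [/\ forall z, z ◁ psi x1 = 1 / (1 + 'i) * z /\
                      z ◁ psi x1 = (1 - 'i) / 2 * z,
            forall z, z ◁ psi x2 = 1 / (1 + 'i) * (- z + 'i) /\
                      z ◁ psi x2 = - ((1 - 'i) / 2) * z + (1 + 'i) / 2,
            forall z, z ◁ psi x3 = 1 / (1 - 'i) * z /\
                      z ◁ psi x3 = (1 + 'i) / 2 * z &
            forall z, z ◁ psi x4 = 1 / (1 - 'i) * (- z + 1) /\
                      z ◁ psi x4 = - ((1 + 'i) / 2) * z + (1 + 'i) / 2],
        (forall (g : H) m (h : H) z,
           z ◁ psi (g •> m <• h) = z ◁ phi g ◁ psi m ◁ phi h),
        (forall (g h : H) (i j : 'I_4),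
           g •> H_basis i = H_basis j <• h ->
           forall z, z ◁ phi g ◁ psi (H_basis i) = z ◁ psi (H_basis j) ◁ phi h) &
        (is_direct_sum (generated_biset [set x1; x2]%classic)
                       (generated_biset [set x3; x4]%classic) /\
         is_direct_sum
           (generated_biset [set iso_biset f x1; iso_biset f x2]%classic)
           (generated_biset [set iso_biset f x3; iso_biset f x4]%classic))].
Proof.
split; first exact: H_is_basis.
have [f [fQ fb]] := ss_iso_corr H_is_basis (@aff_is_basis R) H_section_faithful
  (@aff_section_faithful R) (@corr_div R) (@corr_recursion R) (@corr_total R)
  (@corr_onto R).
exists f => phi psi.
have psiM (g : H) m (h : H) z :
    z ◁ psi (g •> m <• h) = z ◁ phi g ◁ psi m ◁ phi h.
  by rewrite /psi iso_bisetM -!apply_affineM mulgA.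
have psiE i z : z ◁ psi (H_basis i) =
    bslope (aff_basis R i) * z + btrans (aff_basis R i).
  by rewrite /psi fb.
have phiE (g : H) (k : affine_selfsimilar R) z : corr g k ->
    z ◁ phi g = gslope k * z + gtrans k.
  by move=> /fQ e; rewrite /phi e.
have [[s0 t0] [s1 t1] [s2 t2] [s3 t3]] := aff_basisE R.
have n2 := two_neq0 R.
split.
- by split=> z; [rewrite (phiE _ _ z (corrA R))|rewrite (phiE _ _ z (corrB R))
    |rewrite (phiE _ _ z (corrC R))]; rewrite !aff_genE mulN1r ?addr0 ?addrA.
- split=> z; rewrite psiE ?s0 ?s1 ?s2 ?s3 ?t0 ?t1 ?t2 ?t3 ?onePi_inv
    ?oneMi_inv; split; by field: (sqr_iE R).
- exact: psiM.
- move=> g h i j e z.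
  have phi1 y : y ◁ phi (1%g : H) = y by rewrite (phiE _ _ y (corr1 R)) mul1r addr0.
  have := psiM g (H_basis i) 1%g z; rewrite ract1 phi1 => <-.
  by rewrite e -[H_basis j](lact1 (b:=ss_biset H_selfsimilar)) psiM phi1 lact1.
(* The invariant slope lives on the affine side; [f] pulls it back to [H]. *)
have disj : (generated_biset [set x1; x2] `&` generated_biset [set x3; x4] = set0)%classic.
  apply/seteqP; split=> // m [m1 m2].
  suff : (@set0 (ss_biset (affine_selfsimilar R))) (iso_biset f m) by [].
  rewrite -(aff_disjoint R); split; [apply: generated_iso m1|apply: generated_iso m2];
    by move=> u; case=> ->; rewrite fb; [left|right].
rewrite !fb; split; split; try exact: generated_subbiset.
- exact: generated_cover H_is_basis.
- exact: disj.
- exact: generated_cover (@aff_is_basis R).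
- exact: aff_disjoint.
Qed.
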